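(* Let $t=(t_U)_{U \in\mathrm{Proj}_{\bar U_q}}$ be a trace on $\mathrm{Proj}_{\bar U_q}$. Then $$\Pi_{\bar U_q}(t) = t_{\mathcal{X}^+(p)}(\mathrm{Id})\chi^+_p + t_{\mathcal{X}^-(p)}(\mathrm{Id})\chi^-_p + \sum_{s=1}^{p-1} \left(t_{\mathcal{P}^+(s)}(\mathrm{Id})\chi^+_s + t_{\mathcal{P}^-(s)}(\mathrm{Id})\chi^-_s + t_{\mathcal{P}^+(s)}(p^+_s)G_s\right).$$
   Context: Let $p\ge 2$ be an integer, $q=e^{i\pi/p}$, $[n]=\frac{q^n-q^{-n}}{q-q^{-1}}$. $\bar U_q=\bar U_q(\mathfrak{sl}(2))$ is the $2p^3$-dimensional $\mathbb{C}$-algebra generated by $E,F,K$ with relations $E^p=F^p=0$, $K^{2p}=1$, $KE=q^2EK$, $KF=q^{-2}FK$, $EF=FE+\frac{K-K^{-1}}{q-q^{-1}}$. All modules are finite dimensional left modules. Simple modules: for $\alpha\in\{\pm\}$ (identified with $\pm1$) and $1\le s\le p$, $\mathcal{X}^\alpha(s)$ has basis $(v_i)_{0\le i\le s-1}$ with $Kv_i=\alpha q^{s-1-2i}v_i$, $Ev_0=0$, $Ev_i=\alpha[i][s-i]v_{i-1}$ ($i\ge1$), $Fv_i=v_{i+1}$ ($i\le s-2$), $Fv_{s-1}=0$. $\mathcal{X}^\pm(p)$ are also projective. Projective modules: for $1\le s\le p-1$, $\mathcal{P}^\alpha(s)$ (the projective cover of $\mathcal{X}^\alpha(s)$) has a standard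 basis $(b_i,x_j,y_k,a_l)$, $0\le i,l\le s-1$, $0\le j,k\le p-s-1$, with $Kb_i=\alpha q^{s-1-2i}b_i$, $Eb_i=\alpha[i][s-i]b_{i-1}+a_{i-1}$ ($i\ge1$), $Eb_0=x_{p-s-1}$, $Fb_i=b_{i+1}$ ($i\le s-2$), $Fb_{s-1}=y_0$; $Kx_j=-\alpha q^{p-s-1-2j}x_j$, $Ex_j=-\alpha[j][p-s-j]x_{j-1}$ ($j\ge1$), $Ex_0=0$, $Fx_j=x_{j+1}$ ($j\le p-s-2$), $Fx_{p-s-1}=a_0$; $Ky_k=-\alpha q^{p-s-1-2k}y_k$, $Ey_k=-\alpha[k][p-s-k]y_{k-1}$ ($k\ge1$), $Ey_0=a_{s-1}$, $Fy_k=y_{k+1}$ ($k\le p-s-2$), $Fy_{p-s-1}=0$; $Ka_l=\alpha q^{s-1-2l}a_l$, $Ea_l=\alpha[l][s-l]a_{l-1}$ ($l\ge1$), $Ea_0=0$, $Fa_l=a_{l+1}$ ($l\le s-2$), $Fa_{s-1}=0$. $p^\alpha_s\in\mathrm{End}_{\bar U_q}(\mathcal{P}^\alpha(s))$ is the endomorphism determined by $p^\alpha_s(b_0)=a_0$. $\mathrm{SLF}(\bar U_q)$ is the space of linear forms $\varphi$ on $\bar U_q$ with $\varphi(xy)=\varphi(yx)$. Define $\chi^\alpha_s(x)=\mathrm{tr}(x|_{\mathcal{X}^\alpha(s)})$ for $1\le s\le p$. For $1\le s\le p-1$ and $x\in\bar U_q$, let $H^\alpha_s(x)$ be the $s\times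 s$ matrix whose $(l,i)$ entry is the coefficient of $a_l$ in $x b_i$ in the standard basis of $\mathcal{P}^\alpha(s)$, and $G_s=\mathrm{tr}(H^+_s)+\mathrm{tr}(H^-_{p-s})$. It is known that the $\chi^\pm_s$ ($1\le s\le p$) and $G_{s}$ ($1\le s\le p-1$) form a basis of $\mathrm{SLF}(\bar U_q)$. $\mathrm{Proj}_{\bar U_q}$ is the full subcategory of finite dimensional projective left $\bar U_q$-modules. A trace on it is a family of linear maps $t=(t_U:\mathrm{End}_{\bar U_q}(U)\to\mathbb{C})_{U\in \mathrm{Proj}_{\bar U_q}}$ such that $t_U(g\circ f)=t_V(f\circ g)$ for all $f\in\mathrm{Hom}_{\bar U_q}(U,V)$, $g\in\mathrm{Hom}_{\bar U_q}(V,U)$. $\Pi_{\bar U_q}(t)\in\mathrm{SLF}(\bar U_q)$ is defined by $\Pi_{\bar U_q}(t)(a)=t_{\bar U_q}(\rho_a)$, where $\bar U_q$ is the left regular module and $\rho_a(x)=xa$. *)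

(* Defs.v *)
From HB Require Import structures.
From mathcomp Require Import all_boot all_order all_algebra all_field.
From mathcomp Require Import complex.
From mathcomp Require Import boolp reals trigo.

Set Implicit Arguments.
Unset Strict Implicit.
Unset Printing Implicit Defensive.

Import GRing.Theory.
Local Open Scope ring_scope.

Section Modules.
Variables (C : fieldType) (A : falgType C).

(* Finite dimensional left A-modules. *)
Record fdmod := FDMod {
  fdmod_sort :> vectType C;
  act : {linear A -> 'End(fdmod_sort)};
  act1 : act 1 = \1%VF;
  actM : forall x y, act (x * y) = (act x \o act y)%VF
}.

Section Hom.
Variables M N : fdmod.

Definition equivariant : {pred 'Hom(M, N)} :=
  fun f => `[< forall x m, f (act M x m) = act N x (f m) >].

Fact equivariant_submod_closed : submod_closed equivariant.
Proof.
split=> [|c f g /asboolP hf /asboolP hg]; apply/asboolP => x m.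
  by rewrite !lfunE /= linear0.
by rewrite !lfunE /= !lfunE /= hf hg linearP.
Qed.

HB.instance Definition _ :=
  GRing.isSubmodClosed.Build C 'Hom(M, N) equivariant equivariant_submod_closed.

Record modhom := ModHom { homval :> 'Hom(M, N); _ : homval \in equivariant }.

HB.instance Definition _ := [isSub for homval].
HB.instance Definition _ := [Choice of modhom by <:].
HB.instance Definition _ := [SubChoice_isSubLmodule of modhom by <:].

Lemma modhomE (f : modhom) x m : f (act M x m) = act N x (f m).
Proof. by case: f => h /= /asboolP ->. Qed.

End Hom.

Fact idhom_subproof (M : fdmod) : (\1%VF : 'End(M)) \in @equivariant M M.
Proof. by apply/asboolP => x m; rewrite !lfunE. Qed.

Definition idhom (M : fdmod) : modhom M M := ModHom (idhom_subproof M).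

Fact comphom_subproof (L M N : fdmod) (g : modhom M N) (f : modhom L M) :
  (g \o f)%VF \in @equivariant L N.
Proof. by apply/asboolP => x m; rewrite !comp_lfunE !modhomE. Qed.

Definition comphom (L M N : fdmod) (g : modhom M N) (f : modhom L M) :
  modhom L N := ModHom (comphom_subproof g f).

Definition projective (P : fdmod) : Prop :=
  forall (M N : fdmod) (g : modhom M N) (f : modhom P N),
    (forall n : N, exists m : M, g m = n) ->
    exists h : modhom P M, comphom g h = f.

Fact regmod_act1 : amull (1 : A) = \1%VF.
Proof. by apply/lfunP => x; rewrite !lfunE /= mul1r. Qed.

Fact regmod_actM (x y : A) : amull (x * y) = (amull x \o amull y)%VF.
Proof. by apply/lfunP => z; rewrite comp_lfunE !lfunE /= mulrA. Qed.

Definition regmod : fdmod := FDMod regmod_act1 regmod_actM.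

Fact rho_subproof (a : A) : (amulr a : 'End(regmod)) \in @equivariant regmod regmod.
Proof. by apply/asboolP => x m; rewrite !lfunE /= mulrA. Qed.

Definition rho (a : A) : modhom regmod regmod := ModHom (rho_subproof a).

(* A trace on the full subcategory of projective modules is encoded as a total *)
(* family whose values at non-projective modules are unconstrained and never   *)
(* used.                                                                       *)
Definition trace_family := forall M : fdmod, {linear modhom M M -> C^o}.

Definition trace_on_proj (t : trace_family) : Prop :=
  forall (U V : fdmod), projective U -> projective V ->
  forall (f : modhom U V) (g : modhom V U),
    t U (comphom g f) = t V (comphom f g).

Definition Pi (t : trace_family) (a : A) : C := t regmod (rho a).

Definition lfun_tr (V : vectType C) (f : 'End(V)) : C :=
  \tr (passmx.mxof (vbasis {:V}) (vbasis {:V}) f).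

Definition modchar (M : fdmod) (x : A) : C := lfun_tr (act M x).

End Modules.

Inductive pm := Plus | Minus.

Definition pmopp (al : pm) : pm := if al is Plus then Minus else Plus.

Section QuantumSl2.
Variables (C : fieldType) (q : C) (p : nat).

Definition sgn (al : pm) : C := if al is Plus then 1 else -1.

Definition qint (n : nat) : C := (q ^+ n - q ^- n) / (q - q^-1).

Record isUbar (A : falgType C) (E F K : A) : Prop := IsUbar {
  Ubar_E  : E ^+ p = 0;
  Ubar_F  : F ^+ p = 0;
  Ubar_K  : K ^+ (2 * p) = 1;
  Ubar_KE : K * E = q ^+ 2 *: (E * K);
  Ubar_KF : K * F = q ^- 2 *: (F * K);
  Ubar_EF : E * F = F * E + (q - q^-1)^-1 *: (K - K^-1);
  Ubar_gen : agenv <<[:: E; F; K]>>%VS = {:A}%VS;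
  Ubar_dim : \dim {:A} = (2 * p ^ 3)%N
}.

Section StandardModules.
Variables (A : falgType C) (E F K : A).

(* K-weight of the i-th vector of a string of length s and sign al. *)
Definition wt (al : pm) (s i : nat) : C :=
  sgn al * q ^ (s%:Z - 1 - 2 * i%:Z).

(* Only the values v i with i < s (and likewise below) are meaningful. *)
Record isX (al : pm) (s : nat) (X : fdmod A) (v : nat -> X) : Prop := IsX {
  X_basis : basis_of {:X} [tuple v i | i < s];
  X_K  : forall i, (i < s)%N -> act X K (v i) = wt al s i *: v i;
  X_E0 : act X E (v 0%N) = 0;
  X_E  : forall i, (0 < i < s)%N ->
           act X E (v i) = (sgn al * qint i * qint (s - i)) *: v i.-1;
  X_F  : forall i, (i.+1 < s)%N -> act X F (v i) = v i.+1;
  X_Fl : act X F (v s.-1) = 0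
}.

Section StandardBasis.
Variables (al : pm) (s : nat) (P : fdmod A) (b x y a : nat -> P).

(* The ordered basis (b_i, x_j, y_k, a_l). *)
Definition stdbasis : (s + (p - s) + (p - s) + s).-tuple P :=
  [tuple of [tuple of [tuple of [tuple b i | i < s] ++ [tuple x j | j < p - s]]
                      ++ [tuple y k | k < p - s]] ++ [tuple a l | l < s]].

Record isP : Prop := IsP {
  P_basis : basis_of {:P} stdbasis;
  P_Kb  : forall i, (i < s)%N -> act P K (b i) = wt al s i *: b i;
  P_Eb  : forall i, (0 < i < s)%N ->
    act P E (b i) = (sgn al * qint i * qint (s - i)) *: b i.-1 + a i.-1;
  P_Eb0 : act P E (b 0%N) = x (p - s).-1;
  P_Fb  : forall i, (i.+1 < s)%N -> act P F (b i) = b i.+1;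
  P_Fbl : act P F (b s.-1) = y 0%N;
  P_Kx  : forall j, (j < p - s)%N -> act P K (x j) = wt (pmopp al) (p - s) j *: x j;
  P_Ex  : forall j, (0 < j < p - s)%N ->
    act P E (x j) = (- sgn al * qint j * qint (p - s - j)) *: x j.-1;
  P_Ex0 : act P E (x 0%N) = 0;
  P_Fx  : forall j, (j.+1 < p - s)%N -> act P F (x j) = x j.+1;
  P_Fxl : act P F (x (p - s).-1) = a 0%N;
  P_Ky  : forall k, (k < p - s)%N -> act P K (y k) = wt (pmopp al) (p - s) k *: y k;
  P_Ey  : forall k, (0 < k < p - s)%N ->
    act P E (y k) = (- sgn al * qint k * qint (p - s - k)) *: y k.-1;
  P_Ey0 : act P E (y 0%N) = a s.-1;
  P_Fy  : forall k, (k.+1 < p - s)%N -> act P F (y k) = y k.+1;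
  P_Fyl : act P F (y (p - s).-1) = 0;
  P_Ka  : forall l, (l < s)%N -> act P K (a l) = wt al s l *: a l;
  P_Ea  : forall l, (0 < l < s)%N ->
    act P E (a l) = (sgn al * qint l * qint (s - l)) *: a l.-1;
  P_Ea0 : act P E (a 0%N) = 0;
  P_Fa  : forall l, (l.+1 < s)%N -> act P F (a l) = a l.+1;
  P_Fal : act P F (a s.-1) = 0
}.

Definition Hmx (u : A) : 'M[C]_s :=
  \matrix_(l < s, i < s)
    coord stdbasis (rshift (s + (p - s) + (p - s)) l) (act P u (b i)).

End StandardBasis.

End StandardModules.

End QuantumSl2.

Definition qroot (R : realType) (p : nat) : R[i] :=
  (cos (pi / p%:R) +i* sin (pi / p%:R))%C.

(* Main.v *)
From HB Require Import structures.
Require Import Defs.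
From mathcomp Require Import all_boot all_order all_algebra all_field.
From mathcomp Require Import complex.
From mathcomp Require Import boolp reals trigo zify ring.
Set Implicit Arguments.
Unset Strict Implicit.
Unset Printing Implicit Defensive.
Import Order.TTheory GRing.Theory Num.Theory.
Local Open Scope ring_scope.

(** Let [k = (al, s, i)] with [i < s <= p], and let [M_k] be [P^al(s)] with the
    vector [b_i] if [s < p], and [X^al(p)] with the vector [v_i] if [s = p].
    On [b_k] the elements [K] and [F E] act (up to adding [a_i]) by scalars, and
    this pair of scalars determines [k]: the Casimir element gives the block, and
    each [K]-weight occurs once per block.  Since moreover [b_k] generates [M_k],
    the map [u |-> (u b_k)_k] from the algebra to the sum of the [M_k] is onto.
    Both sides have dimension [2 p^3], so it is an isomorphism of modules; hence
    the [M_k] are projective, and pulling back the [b_k] gives idempotents [e_k]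
    with sum [1].  Cyclicity rewrites [t (rho u)] as the sum over [k] of the traces
    of the endomorphisms [b_k |-> e_k u b_k] of [M_k].  These have the form
    [c id + d p^al_s], where [c] is the coefficient of [b_i] and [d] that of [a_i]
    in [u b_i].  Finally [p^+_s = g f] and [p^-_(p-s) = f g] for maps [f], [g]
    between the two projectives of a block, so both have the same trace. *)

(** * Modules separated by vectors *)

Section Retracts.
Variables (C : fieldType) (A : falgType C).
Implicit Types L M N P Q : fdmod A.

Lemma act1E M m : act M 1 m = m.
Proof. by rewrite act1 lfunE. Qed.

Lemma actME M u w m : act M (u * w) m = act M u (act M w m).
Proof. by rewrite actM comp_lfunE. Qed.

Lemma actDE M u w m : act M (u + w) m = act M u m + act M w m.
Proof. by rewrite linearD lfunE. Qed.

Lemma actNE M u m : act M (- u) m = - act M u m.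
Proof. by rewrite linearN lfunE. Qed.

Lemma actBE M u w m : act M (u - w) m = act M u m - act M w m.
Proof. by rewrite actDE actNE. Qed.

Lemma actZE M c u m : act M (c *: u) m = c *: act M u m.
Proof. by rewrite linearZ lfunE. Qed.

Lemma modhom_eqP M N (f g : modhom M N) : (forall m, f m = g m) -> f = g.
Proof. by move=> fg; apply/val_inj/lfunP. Qed.

Lemma idhomE M m : idhom M m = m.
Proof. by rewrite /= lfunE. Qed.

Lemma comphomE L M N (g : modhom M N) (f : modhom L M) m :
  comphom g f m = g (f m).
Proof. exact: comp_lfunE. Qed.

Lemma rhoE (u w : A) : rho u w = w * u.
Proof. by rewrite /= lfunE. Qed.

Definition orbit_fun M (m : M) (u : A) : M := act M u m.

Fact orbit_fun_linear M (m : M) : linear (orbit_fun m).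
Proof. by move=> c u w; rewrite /orbit_fun actDE actZE. Qed.

HB.instance Definition _ M (m : M) :=
  GRing.isSemilinear.Build C A M *:%R (orbit_fun m)
    (GRing.semilinear_linear (orbit_fun_linear m)).

Definition orbit_map M (m : M) : 'Hom(A, M) := linfun (orbit_fun m).

Lemma orbit_mapE M (m : M) u : orbit_map m u = act M u m.
Proof. by rewrite lfunE. Qed.

Fact orbit_hom_subproof M (m : M) :
  orbit_map m \in @equivariant _ _ (regmod A) M.
Proof.
by apply/asboolP => u w; rewrite !orbit_mapE lfunE /= actME.
Qed.

Definition orbit_hom M (m : M) : modhom (regmod A) M :=
  ModHom (orbit_hom_subproof m).

Lemma orbit_homE M (m : M) u : orbit_hom m u = act M u m.
Proof. exact: orbit_mapE. Qed.

Lemma projective_regmod : projective (regmod A).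
Proof.
move=> M N g f gsurj; have [m gm] := gsurj (f (1 : A)).
exists (orbit_hom m); apply: modhom_eqP => u.
rewrite comphomE orbit_homE modhomE gm -modhomE /=.
by rewrite lfunE /= mulr1.
Qed.

Lemma projective_retract P Q (r : modhom P Q) (i : modhom Q P) :
  comphom r i = idhom Q -> projective P -> projective Q.
Proof.
move=> ri projP M N g f gsurj.
have [h gh] := projP M N g (comphom f r) gsurj.
exists (comphom h i); apply: modhom_eqP => m.
have /(congr1 (fun k : modhom P N => k (i m))) := gh.
rewrite !comphomE => ->.
have /(congr1 (fun k : modhom Q Q => k m)) := ri.
by rewrite comphomE idhomE => ->.
Qed.

(** * Splitting the regular module along separated cyclic vectors *)

Section Separated.
Variables (I : eqType) (D : seq I) (M : I -> fdmod A) (b : forall k, M k).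
Hypothesis uniqD : uniq D.
Hypothesis sepD : forall k, k \in D -> forall m : M k,
  exists2 u : A, act (M k) u (b k) = m &
    forall j, j \in D -> j != k -> act (M j) u (b j) = 0.
Hypothesis dimD : (\sum_(k <- D) \dim {:M k} = \dim {:A})%N.

(** For [k] outside [L], [sepD] makes [orbit_map (b k)] map the common annihilator of the [b j], [j]
    in [L], onto [M k]; by rank-nullity each new vector lowers the dimension by exactly
    [\dim {:M k}]. *)
Lemma dim_annihilator (L : seq I) : uniq L -> {subset L <= D} ->
  (\dim (\bigcap_(k <- L) lker (orbit_map (b k))) + \sum_(k <- L) \dim {:M k}
   = \dim {:A})%N.
Proof.
elim: L => [|k L IH] /=; first by rewrite !big_nil addn0.
move=> /andP[kL uL] LD; rewrite !big_cons.
rewrite -[RHS]IH // => [|j jL]; last by apply: LD; rewrite inE jL orbT.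
set W := (\bigcap_(j <- L) _)%VS.
rewrite -[in RHS](limg_ker_dim (orbit_map (b k)) W) capvC -addnA.
congr (_ + (_ + _))%N; congr (\dim _).
apply/eqP; rewrite eqEsubv subvf andbT; apply/subvP => m _.
have [u um u0] := sepD (LD k (mem_head _ _)) m.
rewrite -um -orbit_mapE memv_img // /W.
rewrite big_seq; elim/big_ind: _ => [|V V' uV uV'|j jL].
- exact: memvf.
- by rewrite memv_cap uV uV'.
rewrite memv_ker orbit_mapE u0 //; first by apply: LD; rewrite inE jL orbT.
by apply: contraNneq kL => <-.
Qed.

(** For [L = D] the count [dimD] leaves an annihilator of dimension 0. *)
Lemma separated_faithful (u : A) :
  (forall k, k \in D -> act (M k) u (b k) = 0) -> u = 0.
Proof.
move=> u0; apply/eqP; rewrite -memv0.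
have /eqP := dim_annihilator uniqD (fun _ => id).
rewrite dimD -[X in _ == X]add0n eqn_add2r dimv_eq0 => /eqP <-.
rewrite big_seq; elim/big_ind: _ => [|V V' uV uV'|j jD].
- exact: memvf.
- by rewrite memv_cap uV uV'.
by rewrite memv_ker orbit_mapE u0.
Qed.

Lemma separating_elements : exists e : I -> A,
  forall j k, j \in D -> k \in D ->
    act (M k) (e j) (b k) = if j == k then b k else 0.
Proof.
have e_ j : exists u : A, forall k, j \in D -> k \in D ->
    act (M k) u (b k) = if j == k then b k else 0.
  (* Outside [D] the value 0 is a mere default, which lets [choice] range over all of [I]. *)
  have [jD|jD] := boolP (j \in D); last by exists 0.
  have [u uj u0] := sepD jD (b j); exists u => k _ kD.
  by case: eqVneq => [<-//|jk]; rewrite u0 // eq_sym.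
by have [e eP] := choice e_; exists e => j k; apply: eP.
Qed.

Variable e : I -> A.
Hypothesis eP : forall j k, j \in D -> k \in D ->
  act (M k) (e j) (b k) = if j == k then b k else 0.

(** The intended map is [w b_k |-> w e_k]. The inverse of [orbit_map] picks some [w]; the choice
    does not matter, since the difference of two choices kills [b k], while [e k] kills the other
    [b j]. *)
Definition section_map k : 'Hom(M k, A) :=
  (amulr (e k) \o (orbit_map (b k))^-1)%VF.

Lemma section_mapE k u : k \in D -> section_map k (act (M k) u (b k)) = u * e k.
Proof.
move=> kD; rewrite comp_lfunE lfunE /=; apply/eqP; rewrite -subr_eq0 -mulrBl.
apply/eqP/separated_faithful => j jD; rewrite actME eP //.
case: eqVneq => [<-|]; last by rewrite linear0.
rewrite actBE -orbit_mapE limg_lfunVK ?orbit_mapE ?subrr //.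
by rewrite -orbit_mapE memv_img ?memvf.
Qed.

Fact section_hom_subproof k (kD : k \in D) :
  section_map k \in @equivariant _ _ (M k) (regmod A).
Proof.
apply/asboolP => u m; have [w <- _] := sepD kD m.
by rewrite -actME !section_mapE // lfunE /= mulrA.
Qed.

Definition section_hom k (kD : k \in D) : modhom (M k) (regmod A) :=
  ModHom (section_hom_subproof kD).

(** As [e k] fixes [b k], the element [w e_k] goes back to [w b_k]; thus [M k] is a retract of the
    regular module. *)
Lemma orbit_section k (kD : k \in D) :
  comphom (orbit_hom (b k)) (section_hom kD) = idhom (M k).
Proof.
apply: modhom_eqP => m; rewrite comphomE idhomE.
have [w <- _] := sepD kD m; rewrite orbit_homE section_mapE //.
by rewrite actME eP // eqxx.
Qed.

Lemma projective_separated k : k \in D -> projective (M k).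
Proof.
by move=> kD; apply: projective_retract (orbit_section kD) projective_regmod.
Qed.

Lemma sum_separating : \sum_(k <- D) e k = 1.
Proof.
apply/eqP; rewrite -subr_eq0; apply/eqP/separated_faithful => j jD.
rewrite actBE act1E -orbit_mapE linear_sum /= (bigD1_seq j) //=.
rewrite orbit_mapE eP // eqxx big_seq_cond big1 ?addr0 ?subrr // => k.
by case/andP=> kD kj; rewrite orbit_mapE eP // (negbTE kj).
Qed.

(* [rho u] is the sum of [rho (e k) o rho u], and [rho (e k)] factors through
   [M k], so that cyclicity moves its trace to an endomorphism of [M k]. *)
Lemma Pi_separated (t : trace_family A) (T : I -> C) (u : A) :
  trace_on_proj t ->
  (forall k, k \in D -> exists h : modhom (M k) (M k),
     h (b k) = act (M k) (e k * u) (b k) /\ t (M k) h = T k) ->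
  Pi t u = \sum_(k <- D) T k.
Proof.
move=> ht hT; rewrite /Pi.
have -> : rho u = \sum_(k <- D) rho (u * e k).
  apply: modhom_eqP => w; rewrite rhoE.
  transitivity (\sum_(k <- D) w * (u * e k)).
    by rewrite -!mulr_sumr sum_separating mulr1.
  elim/big_rec2: _ => [|k y1 y2 _ ->]; first by rewrite /= lfunE.
  by rewrite /= lfunE /= lfunE.
rewrite linear_sum /= big_seq [RHS]big_seq; apply: eq_bigr => k kD.
have [h [hb <-]] := hT k kD.
have -> : rho (u * e k) =
    comphom (section_hom kD) (comphom (orbit_hom (b k)) (rho u)).
  apply: modhom_eqP => w; rewrite !comphomE !rhoE orbit_homE.
  by rewrite section_mapE // mulrA.
rewrite ht; [|exact: projective_regmod|exact: projective_separated].
(* The new endomorphism sends [w b_k] to [w e_k u b_k], so it agrees with [h] on the generator [b k]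
   and hence everywhere. *)
congr (t _ _); apply: modhom_eqP => m; rewrite !comphomE.
have [w <- _] := sepD kD m; rewrite section_mapE // rhoE orbit_homE.
by rewrite !actME modhomE hb !actME.
Qed.

End Separated.
End Retracts.

(** * Separating vectors by the joint spectrum of two elements *)

Section Separation.
Variables (C : fieldType) (A : falgType C) (T K : A).
Variables (I : eqType) (D : seq I) (M : I -> fdmod A) (b a : forall k, M k).
Variables wt mu : I -> C.
Hypothesis Kb : forall k, k \in D -> act (M k) K (b k) = wt k *: b k.
Hypothesis Ka : forall k, k \in D -> act (M k) K (a k) = wt k *: a k.
Hypothesis Tb : forall k, k \in D -> act (M k) T (b k) = mu k *: b k + a k.
Hypothesis Ta : forall k, k \in D -> act (M k) T (a k) = mu k *: a k.
Hypothesis wt_mu_inj : forall j k, j \in D -> k \in D ->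
  wt j = wt k -> mu j = mu k -> j = k.
Hypothesis cyclic_b : forall k, k \in D -> forall (c d : C) (m : M k), c != 0 ->
  exists u, act (M k) u (c *: b k + d *: a k) = m.

(** Triangular action on [b j], [a j] with the single eigenvalue [c], phrased by formulas and not by
    a matrix because [a j] may be 0. *)
Definition upper j (u : A) (c : C) :=
  (exists d, act (M j) u (b j) = c *: b j + d *: a j) /\
  act (M j) u (a j) = c *: a j.

Lemma upper1 j : upper j 1 1.
Proof. by split; [exists 0|]; rewrite act1E scale1r ?scale0r ?addr0. Qed.

Lemma upperM j u w c d : upper j u c -> upper j w d -> upper j (u * w) (c * d).
Proof.
move=> [[cu ub] ua] [[cw wb] wa]; split.
  exists (d * cu + cw * c); rewrite actME wb linearD !linearZ /= ub ua.
  by rewrite scalerDr !scalerA (mulrC d c) -addrA -scalerDl.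
by rewrite actME wa linearZ /= ua scalerA mulrC.
Qed.

Lemma upperK j c : j \in D -> upper j (K - c%:A) (wt j - c).
Proof.
move=> jD; split; last by rewrite actBE actZE act1E Ka // scalerBl.
by exists 0; rewrite actBE actZE act1E Kb // scalerBl scale0r addr0.
Qed.

Lemma upperT j c : j \in D -> upper j (T - c%:A) (mu j - c).
Proof.
move=> jD; split; last by rewrite actBE actZE act1E Ta // scalerBl.
by exists 1; rewrite actBE actZE act1E Tb // scalerBl scale1r addrAC.
Qed.

(** On [b j] the element [T - mu j] leaves [a j], which a second factor kills: hence the square.
    When the weights differ, the linear factor in [K] already separates. *)
Definition sep_factor k j : A :=
  if wt j == wt k then (T - (mu j)%:A) * (T - (mu j)%:A) else K - (wt j)%:A.

Lemma sep_factor_upper k j i : i \in D -> exists c, upper i (sep_factor k j) c.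
Proof.
move=> iD; rewrite /sep_factor; case: ifP => _; eexists.
  by apply: upperM; apply: upperT.
exact: upperK.
Qed.

Lemma sep_factor_neq0 k j : j \in D -> k \in D -> j != k ->
  exists2 c, c != 0 & upper k (sep_factor k j) c.
Proof.
move=> jD kD jk; rewrite /sep_factor; case: eqP => w.
  exists ((mu k - mu j) * (mu k - mu j)); last by apply: upperM; apply: upperT.
  have kj : mu k - mu j != 0.
    rewrite subr_eq0; apply: contraNneq jk => m.
    by apply/eqP; apply: wt_mu_inj.
  exact: mulf_neq0.
exists (wt k - wt j); last exact: upperK.
by rewrite subr_eq0; apply/eqP => /esym.
Qed.

Lemma sep_factor_kill k j : j \in D ->
  act (M j) (sep_factor k j) (b j) = 0 /\ act (M j) (sep_factor k j) (a j) = 0.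
Proof.
move=> jD; rewrite /sep_factor; case: ifP => _.
  have ka : act (M j) (T - (mu j)%:A) (a j) = 0.
    by rewrite actBE actZE act1E Ta // subrr.
  have kb : act (M j) (T - (mu j)%:A) (b j) = a j.
    by rewrite actBE actZE act1E Tb // addrAC subrr add0r.
  by rewrite !actME kb ka linear0.
by rewrite !actBE !actZE !act1E Kb // Ka // !subrr.
Qed.

(** The product of the factors for all [j != k] kills each such [b j] and sends [b k] to
    [c b_k + d a_k] with [c != 0], a vector from which [cyclic_b] reaches any [m]. *)
Lemma spectral_separation k (m : M k) : k \in D ->
  exists2 u : A, act (M k) u (b k) = m &
    forall j, j \in D -> j != k -> act (M j) u (b j) = 0.
Proof.
move=> kD; pose Z L := \prod_(j <- L) sep_factor k j.
have Zup L i : i \in D -> exists c, upper i (Z L) c.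
  move=> iD; rewrite /Z; elim/big_rec: _ => [|j z _ [c zc]].
    by exists 1; apply: upper1.
  by have [d jd] := sep_factor_upper k j iD; exists (d * c); apply: upperM.
have Zk L : {subset L <= D} -> k \notin L ->
    exists2 c, c != 0 & upper k (Z L) c.
  rewrite /Z; elim: L => [|j L IH] LD kL.
    by rewrite big_nil; exists 1; rewrite ?oner_eq0 //; apply: upper1.
  move: kL; rewrite inE negb_or => /andP[kj kL].
  have LD' : {subset L <= D} by move=> i iL; apply: LD; rewrite inE iL orbT.
  have [c c0 Zc] := IH LD' kL.
  have [|d d0 jd] := sep_factor_neq0 (LD j (mem_head _ _)) kD.
    by rewrite eq_sym.
  rewrite big_cons; exists (d * c); [exact: mulf_neq0|exact: upperM].
have Z0 L j : j \in L -> j \in D -> act (M j) (Z L) (b j) = 0.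
  rewrite /Z; elim: L => [//|i L IH]; rewrite inE big_cons actME => jL jD.
  have [jL'|jL'] := boolP (j \in L); first by rewrite IH // linear0.
  move: jL; rewrite (negbTE jL') orbF => /eqP <-{i}.
  (* Here [j] heads the list and [Z L] keeps [b j] in the span of [b j] and [a j], both killed by
     the head factor. *)
  have [c [[d ->] _]] := Zup L j jD; have [kb ka] := sep_factor_kill k jD.
  by rewrite linearD !linearZ /= kb ka !scaler0 addr0.
(* [undup] ensures that [rem] removes every occurrence of [k]. *)
pose L := rem k (undup D).
have LE j : (j \in L) = (j != k) && (j \in D).
  by rewrite mem_rem_uniq ?undup_uniq // inE mem_undup.
have LD : {subset L <= D} by move=> j; rewrite LE => /andP[].
have [|c c0 [[d Zb] _]] := Zk L LD; first by rewrite LE eqxx.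
have [u um] := cyclic_b kD d m c0.
exists (u * Z L); first by rewrite actME Zb um.
by move=> j jD jk; rewrite actME Z0 ?linear0 // LE jk.
Qed.

End Separation.

(** * Strings of weight vectors *)

(** Expanding the vectors of [vbasis] in [v], and the images [f v_j] in [vbasis], gives the same
    double sum in two orders. *)
Lemma lfun_tr_basis (C : fieldType) (V : vectType C) n (v : n.-tuple V)
    (f : 'End(V)) :
  basis_of {:V} v -> lfun_tr f = \sum_(i < n) coord v i (f (tnth v i)).
Proof.
move=> vB; set e := vbasis {:V}.
have eB : basis_of {:V} e := vbasisP _.
have -> : lfun_tr f = \sum_(i < \dim {:V}) coord e i (f e`_i).
  by apply: eq_bigr => i _; rewrite !mxE /= passmx.vecof_delta.
transitivity (\sum_(i < \dim {:V}) \sum_(j < n)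
                 coord v j e`_i * coord e i (f (tnth v j))).
  apply: eq_bigr => i _; rewrite [X in f X](coord_basis vB (memvf e`_i)).
  rewrite !linear_sum; apply: eq_bigr => j _.
  by rewrite !linearZ /= !(tnth_nth 0).
rewrite exchange_big; apply: eq_bigr => j _ /=.
rewrite [in RHS](coord_basis eB (memvf (f (tnth v j)))) linear_sum.
by apply: eq_bigr => i _; rewrite linearZ /= mulrC.
Qed.

(** * Equivariance checked on generators *)

Section Intertwiners.
Variables (C : fieldType) (A : falgType C) (M N : fdmod A) (f : 'Hom(M, N)).

Definition commutator (u : A) : 'Hom(M, N) := ((f \o act M u) - (act N u \o f))%VF.

Lemma commutatorE u m : commutator u m = f (act M u m) - act N u (f m).
Proof. by rewrite /commutator add_lfunE opp_lfunE !comp_lfunE. Qed.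

Fact commutator_linear : linear commutator.
Proof.
move=> c u w; apply/lfunP => m; rewrite [RHS]add_lfunE [X in _ = X + _]scale_lfunE.
rewrite !commutatorE.
by rewrite !actDE !actZE linearP scalerBr opprD addrACA.
Qed.

HB.instance Definition _ :=
  GRing.isSemilinear.Build C A 'Hom(M, N) *:%R commutator
    (GRing.semilinear_linear commutator_linear).

(** The elements commuting with [f] form the kernel of the linear map [commutator]; it contains 1
    and is stable under left multiplication by the generators, hence contains the algebra they
    generate. *)
Lemma equivariant_gen (X : seq A) :
  agenv <<X>>%VS = {:A}%VS ->
  (forall u, u \in X -> forall m, f (act M u m) = act N u (f m)) ->
  f \in @equivariant _ _ M N.
Proof.
move=> genX fX; pose V := lker (linfun commutator).
have VP u : reflect (forall m, f (act M u m) = act N u (f m)) (u \in V).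
  rewrite memv_ker lfunE /=; apply: (iffP eqP) => [u0 m|fu].
    by apply/eqP; rewrite -subr_eq0 -commutatorE u0 lfunE.
  by apply/lfunP => m; rewrite commutatorE fu subrr lfunE.
suff Vf : (agenv <<X>> <= V)%VS.
  by apply/asboolP => u m; apply/VP; apply: (subvP Vf); rewrite genX memvf.
have XV : (<<X>> <= V)%VS by apply/span_subvP => u /fX fu; apply/VP.
apply: agenv_sub_modl.
  by rewrite -memvE; apply/VP => m; rewrite !act1E.
apply/prodvP => u w uX /VP fw; apply/VP => m.
by have /VP fu := subvP XV u uX; rewrite !actME fu fw.
Qed.

End Intertwiners.

Lemma sgnN (C : fieldType) al : sgn C (pmopp al) = - sgn C al.
Proof. by case: al; rewrite /= ?opprK. Qed.

(** * Strings and the modules built from them *)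

Section Strings.
Variables (C : fieldType) (q : C) (p : nat) (A : falgType C) (E F K : A).
Hypothesis genA : agenv <<[:: E; F; K]>>%VS = {:A}%VS.
Hypothesis qint_neq0 : forall n, (0 < n < p)%N -> qint q n != 0.
Implicit Types (M N : fdmod A) (al : pm) (s i : nat).

(** The relations shared by [v], [a], [x] and [y], without the rules for [E] at the first and [F] at
    the last vector, which differ from case to case. Zero strings are allowed. *)
Record string M al n (v : nat -> M) : Prop := String {
  string_K : forall i, (i < n)%N -> act M K (v i) = wt q al n i *: v i;
  string_E : forall i, (0 < i < n)%N ->
    act M E (v i) = (sgn C al * qint q i * qint q (n - i)) *: v i.-1;
  string_F : forall i, (i.+1 < n)%N -> act M F (v i) = v i.+1 }.

Lemma string0 M al n : string al n (fun _ => 0 : M).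
Proof. by split=> *; rewrite linear0 ?scaler0. Qed.

Lemma sgn_neq0 al : sgn C al != 0.
Proof. by case: al; rewrite ?oppr_eq0 oner_eq0. Qed.

Lemma string_coef_neq0 al n i :
  (n <= p)%N -> (0 < i < n)%N -> sgn C al * qint q i * qint q (n - i) != 0.
Proof.
move=> np i_n; apply: mulf_neq0; last by apply: qint_neq0; lia.
by apply: mulf_neq0; [exact: sgn_neq0|apply: qint_neq0; lia].
Qed.

(* [v] is a string only modulo [V]: this covers the vectors [b_i] of [P]. *)
Lemma string_sub M (V : {vspace M}) al n (v : nat -> M) i j :
  (n <= p)%N ->
  (forall u m, m \in V -> act M u m \in V) ->
  (forall i, (0 < i < n)%N ->
    act M E (v i) - (sgn C al * qint q i * qint q (n - i)) *: v i.-1 \in V) ->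
  (forall i, (i.+1 < n)%N -> act M F (v i) = v i.+1) ->
  (i < n)%N -> (j < n)%N -> v i \in V -> v j \in V.
Proof.
move=> np stV vE vF i_n j_n vi.
(* Modulo [V], [E] leads down from [v i] to [v 0] with coefficients that are nonzero as [n <= p];
   then [F] leads up to [v j]. *)
have v0 : v 0%N \in V.
  elim: i i_n vi => [//|i IH] i_n vi; apply: IH; first exact: ltnW.
  have := memvB (stV E _ vi) (vE i.+1 i_n).
  rewrite opprB addrC subrK rpredZeq.
  by rewrite (negbTE (string_coef_neq0 al np _)).
by elim: j j_n => [//|j IH] j_n; rewrite -vF // stV // IH // ltnW.
Qed.

Lemma string_FE M al n (v : nat -> M) i :
  string al n v -> act M E (v 0%N) = 0 -> (i < n)%N ->
  act M (F * E) (v i) = (sgn C al * qint q i * qint q (n - i)) *: v i.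
Proof.
move=> vS v0; rewrite actME; case: i => [_|i i_n].
  by rewrite v0 linear0 /qint expr0 invr1 subrr mul0r mulr0 mul0r scale0r.
by rewrite (string_E vS) // linearZ /= (string_F vS).
Qed.

(** The orbit of [m0] is itself a stable subspace containing [m0], so the hypothesis applies to
    it. *)
Lemma cyclic_of_stable M (m0 : M) :
  (forall V : {vspace M}, (forall u m, m \in V -> act M u m \in V) ->
     m0 \in V -> (fullv <= V)%VS) ->
  forall m, exists u, act M u m0 = m.
Proof.
move=> mV m; pose V := limg (orbit_map m0).
have /subvP/(_ m (memvf m))/memv_imgP[u _ ->] : (fullv <= V)%VS.
  apply: mV => [u z /memv_imgP[w _ ->]|].
    by rewrite orbit_mapE -actME -orbit_mapE memv_img ?memvf.
  by rewrite -[m0]act1E -orbit_mapE memv_img ?memvf.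
by exists u; rewrite orbit_mapE.
Qed.

(** * The simple modules *)

Section Simple.
Variables (al : pm) (s : nat) (X : fdmod A) (v : nat -> X).
Hypotheses (s_p : (0 < s <= p)%N) (hX : isX q E F K al s v).

Lemma string_isX : string al s v.
Proof. by split; [exact: X_K hX|exact: X_E hX|exact: X_F hX]. Qed.

Lemma dim_isX : \dim {:X} = s.
Proof. exact: size_basis (X_basis hX). Qed.

Lemma cyclic_isX i (m : X) (c : C) : (i < s)%N -> c != 0 ->
  exists u, act X u (c *: v i) = m.
Proof.
move=> i_s c0; have /andP[_ sp] := s_p; move: m.
apply: cyclic_of_stable => V stV.
rewrite rpredZeq (negbTE c0) /= => vi.
rewrite -(span_basis (X_basis hX)).
apply/span_subvP => z /mapP[j _ ->].
apply: (string_sub (al := al) sp stV _ (string_F string_isX) i_s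
  (ltn_ord j) vi) => k ks.
by rewrite (string_E string_isX) // subrr mem0v.
Qed.

End Simple.

(** * The projective modules and maps out of them *)

Section Projective.
Variables (al : pm) (s : nat) (P : fdmod A) (b x y a : nat -> P).
Hypotheses (s_p : (0 < s < p)%N) (hP : isP q p E F K al s b x y a).
Local Notation s' := (p - s)%N.
Local Notation B := (stdbasis p s b x y a).

Let s_le_p : (s <= p)%N. Proof. by lia. Qed.
Let s'_le_p : (s' <= p)%N. Proof. by lia. Qed.
Let s_gt0 : (0 < s)%N. Proof. by lia. Qed.
Let s'_gt0 : (0 < s')%N. Proof. by lia. Qed.

Lemma string_isP_a : string al s a.
Proof. by split; [exact: P_Ka hP|exact: P_Ea hP|exact: P_Fa hP]. Qed.

Lemma string_isP_x : string (pmopp al) s' x.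
Proof.
split; [exact: P_Kx hP| |exact: P_Fx hP] => i.
by rewrite sgnN; apply: (P_Ex hP).
Qed.

Lemma string_isP_y : string (pmopp al) s' y.
Proof.
split; [exact: P_Ky hP| |exact: P_Fy hP] => i.
by rewrite sgnN; apply: (P_Ey hP).
Qed.

Lemma dim_isP : \dim {:P} = (2 * p)%N.
Proof. by rewrite (size_basis (P_basis hP)); lia. Qed.

(** The formula is uniform in [i]: for [i = 0] the factor [[i]] vanishes and [a_0] is [F x_{p-s-1}],
    while for [i > 0] the term [a_i] is [F a_{i-1}]. *)
Lemma isP_FEb i : (i < s)%N ->
  act P (F * E) (b i) = (sgn C al * qint q i * qint q (s - i)) *: b i + a i.
Proof.
rewrite actME; case: i => [_|i i_s].
  rewrite (P_Eb0 hP) (P_Fxl hP) /qint expr0 invr1 subrr.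
  by rewrite mul0r mulr0 mul0r scale0r add0r.
by rewrite (P_Eb hP) // linearD linearZ /= (P_Fb hP) ?(P_Fa hP).
Qed.

Definition ord_b (i : 'I_s) : 'I_(s + s' + s' + s) :=
  lshift s (lshift s' (lshift s' i)).
Definition ord_x (j : 'I_s') : 'I_(s + s' + s' + s) :=
  lshift s (lshift s' (rshift s j)).
Definition ord_y (k : 'I_s') : 'I_(s + s' + s' + s) :=
  lshift s (rshift (s + s') k).
Definition ord_a (l : 'I_s) : 'I_(s + s' + s' + s) := rshift (s + s' + s') l.

Lemma big_stdbasis (R : Type) (idx : R) (op : Monoid.law idx) f :
  \big[op/idx]_r f r =
  op (op (op (\big[op/idx]_i f (ord_b i)) (\big[op/idx]_j f (ord_x j)))
         (\big[op/idx]_k f (ord_y k))) (\big[op/idx]_l f (ord_a l)).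
Proof. by rewrite !big_split_ord. Qed.

Lemma stdbasisE N (wb wx wy wa : nat -> N) (W := stdbasis p s wb wx wy wa) :
  [/\ forall i : 'I_s, tnth W (ord_b i) = wb i,
      forall j : 'I_s', tnth W (ord_x j) = wx j,
      forall k : 'I_s', tnth W (ord_y k) = wy k
    & forall l : 'I_s, tnth W (ord_a l) = wa l].
Proof.
rewrite /W /stdbasis.
by split=> i; rewrite ?tnth_lshift ?tnth_rshift ?tnth_mktuple.
Qed.

Lemma isP_ind (V : {vspace P}) :
  (forall i, (i < s)%N -> b i \in V) -> (forall j, (j < s')%N -> x j \in V) ->
  (forall k, (k < s')%N -> y k \in V) -> (forall l, (l < s)%N -> a l \in V) ->
  (fullv <= V)%VS.
Proof.
move=> Vb Vx Vy Va; rewrite -(span_basis (P_basis hP)); apply/span_subvP => z.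
rewrite !mem_cat -!orbA => /or4P[] /mapP[i _ ->].
- exact: Vb.
- exact: Vx.
- exact: Vy.
exact: Va.
Qed.

Lemma isP_eq_lfun (V : vectType C) (f g : 'Hom(P, V)) :
  (forall i, (i < s)%N -> f (b i) = g (b i)) ->
  (forall j, (j < s')%N -> f (x j) = g (x j)) ->
  (forall k, (k < s')%N -> f (y k) = g (y k)) ->
  (forall l, (l < s)%N -> f (a l) = g (a l)) -> f = g.
Proof.
move=> fb fx fy fa; suff /subvP fg : (fullv <= lker (f - g))%VS.
  apply/lfunP => m; apply/eqP; rewrite -subr_eq0 -opp_lfunE -add_lfunE.
  by rewrite -memv_ker fg ?memvf.
by apply: isP_ind => i i_s; rewrite memv_ker add_lfunE opp_lfunE subr_eq0;
  apply/eqP; auto.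
Qed.

Lemma isP_expand (V : vectType C) (f : 'Hom(P, V)) m :
  f m = \sum_i coord B (ord_b i) m *: f (b i)
      + \sum_j coord B (ord_x j) m *: f (x j)
      + \sum_k coord B (ord_y k) m *: f (y k)
      + \sum_l coord B (ord_a l) m *: f (a l).
Proof.
have [tb tx ty ta] := stdbasisE b x y a.
have {1}-> : m = \sum_r coord B r m *: tnth B r.
  rewrite [LHS](coord_basis (P_basis hP) (memvf m)).
  by apply: eq_bigr => r _; rewrite (tnth_nth 0).
rewrite linear_sum big_stdbasis.
by congr (_ + _ + _ + _); apply: eq_bigr => i _;
  rewrite linearZ ?tb ?tx ?ty ?ta.
Qed.

Lemma isP_lfun N (wb wx wy wa : nat -> N) : exists f : 'Hom(P, N),
  [/\ forall i, (i < s)%N -> f (b i) = wb i,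
      forall j, (j < s')%N -> f (x j) = wx j,
      forall k, (k < s')%N -> f (y k) = wy k
    & forall l, (l < s)%N -> f (a l) = wa l].
Proof.
have [f fE] := linear_of_free B (stdbasis p s wb wx wy wa).
exists (linfun f).
have fr r : f (tnth B r) = tnth (stdbasis p s wb wx wy wa) r.
  rewrite (tnth_nth 0) -(nth_map 0 0) ?size_tuple // fE ?size_tuple //.
    by rewrite -tnth_nth.
  exact: basis_free (P_basis hP).
have [tb tx ty ta] := stdbasisE b x y a.
have [ub ux uy ua] := stdbasisE wb wx wy wa.
split=> i i_s; rewrite lfunE /=.
- by have := fr (ord_b (Ordinal i_s)); rewrite tb ub.
- by have := fr (ord_x (Ordinal i_s)); rewrite tx ux.
- by have := fr (ord_y (Ordinal i_s)); rewrite ty uy.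
by have := fr (ord_a (Ordinal i_s)); rewrite ta ua.
Qed.

(** Covers the maps onto the simple top and between linked projectives: all kill the [a_l], so the
    relations left to check are those of three strings and of their ends. *)
Lemma isP_hom N (wb wx wy : nat -> N) :
  string al s wb -> string (pmopp al) s' wx -> string (pmopp al) s' wy ->
  act N E (wb 0%N) = wx s'.-1 -> act N F (wb s.-1) = wy 0%N ->
  act N E (wx 0%N) = 0 -> act N F (wx s'.-1) = 0 ->
  act N E (wy 0%N) = 0 -> act N F (wy s'.-1) = 0 ->
  exists f : modhom P N,
    [/\ forall i, (i < s)%N -> f (b i) = wb i,
        forall j, (j < s')%N -> f (x j) = wx j,
        forall k, (k < s')%N -> f (y k) = wy k
      & forall l, (l < s)%N -> f (a l) = 0].
Proof.
move=> sb sx sy Eb Fb Ex Fx Ey Fy.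
have [f [fb fx fy fa]] := isP_lfun wb wx wy (fun=> 0).
suff eqf : f \in @equivariant _ _ P N by exists (ModHom eqf).
have pred_lt n : (0 < n)%N -> (n.-1 < n)%N by case: n.
apply: (equivariant_gen genA) => u uEFK m; rewrite -!comp_lfunE.
suff -> : (f \o act P u)%VF = (act N u \o f)%VF by [].
(* [E] has its own rule at index 0, [F] at the last index; this is the case split for [F]. *)
have last_eq n i : (i < n)%N -> (i.+1 < n)%N \/ i = n.-1 by lia.
move: uEFK; rewrite !inE => /or3P[] /eqP->{u m}.
- apply: isP_eq_lfun => -[|i] i_s; rewrite !comp_lfunE /=.
  + by rewrite (P_Eb0 hP) fx ?fb ?pred_lt.
  + rewrite (P_Eb hP) // linearD linearZ /= !fb // 1?fa //; try exact: ltnW.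
    by rewrite (string_E sb) // addr0.
  + by rewrite (P_Ex0 hP) linear0 fx.
  + rewrite (P_Ex hP) // linearZ /= !fx //; try exact: ltnW.
    by rewrite (string_E sx) // sgnN.
  + by rewrite (P_Ey0 hP) fa ?fy ?pred_lt.
  + rewrite (P_Ey hP) // linearZ /= !fy //; try exact: ltnW.
    by rewrite (string_E sy) // sgnN.
  + by rewrite (P_Ea0 hP) fa // !linear0.
  rewrite (P_Ea hP) // linearZ /= !fa //; try exact: ltnW.
  by rewrite !linear0.
- apply: isP_eq_lfun => i i_s; rewrite !comp_lfunE /=;
    have [i1|iE] := last_eq _ _ i_s.
  + by rewrite (P_Fb hP) // !fb // (string_F sb).
  + by rewrite iE (P_Fbl hP) fy // fb ?pred_lt.
  + by rewrite (P_Fx hP) // !fx // (string_F sx).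
  + by rewrite iE (P_Fxl hP) fa // fx ?pred_lt.
  + by rewrite (P_Fy hP) // !fy // (string_F sy).
  + by rewrite iE (P_Fyl hP) fy ?pred_lt // linear0.
  + by rewrite (P_Fa hP) // !fa // linear0.
  by rewrite iE (P_Fal hP) fa ?pred_lt // !linear0.
apply: isP_eq_lfun => i i_s; rewrite !comp_lfunE /=.
- by rewrite (P_Kb hP) // linearZ /= fb // (string_K sb).
- by rewrite (P_Kx hP) // linearZ /= fx // (string_K sx).
- by rewrite (P_Ky hP) // linearZ /= fy // (string_K sy).
by rewrite (P_Ka hP) // linearZ /= fa // !linear0.
Qed.

(** Subtracting its eigenvalue from [F E] yields [c a_i], so a stable subspace containing the vector
    contains [a_i] and [b_i]. The strings then give all [a_j] and, modulo these, all [b_j]; [E b_0]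
    and [F b_{s-1}] lead into the strings [x] and [y]. *)
Lemma cyclic_isP i (m : P) (c d : C) : (i < s)%N -> c != 0 ->
  exists u, act P u (c *: b i + d *: a i) = m.
Proof.
move=> i_s c0; move: m; apply: cyclic_of_stable => V stV Vm0.
have pred_lt n : (0 < n)%N -> (n.-1 < n)%N by case: n.
have Vai : a i \in V.
  set mu := sgn C al * qint q i * qint q (s - i).
  have <- : c^-1 *: (act P (F * E) (c *: b i + d *: a i)
                     - mu *: (c *: b i + d *: a i)) = a i.
    have -> : act P (F * E) (c *: b i + d *: a i)
              = c *: (mu *: b i + a i) + d *: (mu *: a i).
      rewrite linearD /= [act P (F * E) (c *: b i)]linearZ /=.
      rewrite [act P (F * E) (d *: a i)]linearZ /=.
      rewrite isP_FEb //.
      by rewrite (string_FE string_isP_a (P_Ea0 hP)).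
    have -> : c *: (mu *: b i + a i) + d *: (mu *: a i)
              = mu *: (c *: b i + d *: a i) + c *: a i.
      by rewrite !scalerDr !scalerA (mulrC c) (mulrC d) addrAC.
    by rewrite addrAC subrr add0r scalerA mulVf ?scale1r.
  by rewrite memvZ // memvB ?memvZ // stV.
have Va j : (j < s)%N -> a j \in V.
  move=> j_s.
  apply: (string_sub (al := al) s_le_p stV _ (P_Fa hP) i_s j_s Vai) => k ks.
  by rewrite (P_Ea hP) // subrr mem0v.
have Vbi : b i \in V.
  have := memvB Vm0 (memvZ d Vai).
  by rewrite addrK rpredZeq (negbTE c0).
have Vb j : (j < s)%N -> b j \in V.
  move=> j_s.
  apply: (string_sub (al := al) s_le_p stV _ (P_Fb hP) i_s j_s Vbi) => k ks.
  by rewrite (P_Eb hP) // addrC addKr Va //; lia.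
apply: isP_ind => // j j_s.
  have Vx : x s'.-1 \in V by rewrite -(P_Eb0 hP) stV // Vb.
  apply: (string_sub (al := pmopp al) s'_le_p stV _ (P_Fx hP)
    (pred_lt _ s'_gt0) j_s Vx) => k ks.
  by rewrite (string_E string_isP_x) // subrr mem0v.
have Vy : y 0%N \in V by rewrite -(P_Fbl hP) stV // Vb // pred_lt.
apply: (string_sub (al := pmopp al) s'_le_p stV _ (P_Fy hP) s'_gt0 j_s Vy) => k ks.
by rewrite (string_E string_isP_y) // subrr mem0v.
Qed.

Lemma isP_hom_eq N (f g : modhom P N) i :
  (i < s)%N -> f (b i) = g (b i) -> f = g.
Proof.
move=> i_s fg; apply: modhom_eqP => m.
have [u <-] := cyclic_isP m 0 i_s (oner_neq0 C).
by rewrite scale1r scale0r addr0 !modhomE fg.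
Qed.

Lemma isP_nilp_b (f : modhom P P) i :
  f (b 0%N) = a 0%N -> (i < s)%N -> f (b i) = a i.
Proof.
move=> f0; elim: i => [//|i IH] i_s.
by rewrite -(P_Fb hP) // modhomE IH ?(P_Fa hP) // ltnW.
Qed.

End Projective.

Lemma modchar_isX al s (X : fdmod A) (v : nat -> X) (u : A) :
  isX q E F K al s v ->
  modchar X u = \sum_(i < s) coord [tuple v j | j < s] i (act X u (v i)).
Proof.
move=> hX; rewrite /modchar (lfun_tr_basis _ (X_basis hX)).
by apply: eq_bigr => i _; rewrite tnth_mktuple.
Qed.

(* [P] maps onto its simple top by [b_i |-> v_i], [x, y, a |-> 0]. *)
Lemma coord_top al s (P X : fdmod A) (b x y a : nat -> P) (v : nat -> X)
    (i j : 'I_s) u :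
  (0 < s < p)%N -> isP q p E F K al s b x y a -> isX q E F K al s v ->
  coord (stdbasis p s b x y a) (ord_b i) (act P u (b j)) =
  coord [tuple v j | j < s] i (act X u (v j)).
Proof.
move=> s_p hP hX.
have [||||||f [fb fx fy fa]] := isP_hom s_p hP (string_isX hX)
  (string0 X (pmopp al) (p - s)) (string0 X (pmopp al) (p - s));
  rewrite ?linear0 //.
- exact: X_E0 hX.
- exact: X_Fl hX.
rewrite -(fb j) // -modhomE (isP_expand hP f).
rewrite [X in _ + X + _ + _]big1 => [|k _]; last by rewrite fx ?scaler0.
rewrite [X in _ + X + _]big1 => [|k _]; last by rewrite fy ?scaler0.
rewrite [X in _ + X]big1 => [|k _]; last by rewrite fa ?scaler0.
rewrite !addr0 linear_sum (bigD1 i) //= big1 => [|k ki]; rewrite fb // linearZ /=.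
  have := coord_free i i (basis_free (X_basis hX)).
  by rewrite -tnth_nth tnth_mktuple eqxx addr0 => ->; rewrite mulr1.
have := coord_free k i (basis_free (X_basis hX)).
by rewrite -tnth_nth tnth_mktuple (negbTE ki) => ->; rewrite mulr0.
Qed.

(** * Maps between the two projectives of a block *)

Section Pair.
Variables (al al2 : pm) (s s2 : nat) (P P2 : fdmod A).
Variables (b x y a : nat -> P) (b2 x2 y2 a2 : nat -> P2).
Hypotheses (s_gt0 : (0 < s)%N) (s2_gt0 : (0 < s2)%N) (s_s2 : (s + s2 = p)%N).
Hypothesis al_al2 : al2 = pmopp al.
Hypotheses (hP : isP q p E F K al s b x y a).
Hypotheses (hP2 : isP q p E F K al2 s2 b2 x2 y2 a2).

Let s_p : (0 < s < p)%N. Proof. by lia. Qed.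
Let s2E : (p - s = s2)%N. Proof. by lia. Qed.
Let sE : (p - s2 = s)%N. Proof. by lia. Qed.
Let alE : pmopp al2 = al. Proof. by rewrite al_al2; case: al. Qed.

(** As [p - s2 = s], the string [x2] has the length and sign of [b], and [F b_{s-1} = y_0] matches
    [F x2_{s-1} = a2_0]. *)
Lemma isP_hom_x : exists f : modhom P P2,
  [/\ forall i, (i < s)%N -> f (b i) = x2 i, forall j, (j < s2)%N -> f (x j) = 0
    & forall k, (k < s2)%N -> f (y k) = a2 k].
Proof.
have := string_isP_x hP2; rewrite alE sE => sx.
have := string_isP_a hP2; rewrite al_al2 -{1}s2E => sa.
have [||||||f [fb fx fy _]] := isP_hom s_p hP sx (string0 P2 (pmopp al) (p - s)) sa;
  rewrite ?linear0 ?s2E //.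
- exact: P_Ex0 hP2.
- by have := P_Fxl hP2; rewrite sE.
- exact: P_Ea0 hP2.
- exact: P_Fal hP2.
by exists f; split=> // i; rewrite -s2E => ?; [exact: fx|exact: fy].
Qed.

(** Here [E b_0 = x_{s2-1}] matches [E y2_0 = a2_{s2-1}]. *)
Lemma isP_hom_y : exists g : modhom P P2,
  [/\ forall i, (i < s)%N -> g (b i) = y2 i, forall j, (j < s2)%N -> g (x j) = a2 j
    & forall k, (k < s2)%N -> g (y k) = 0].
Proof.
have := string_isP_y hP2; rewrite alE sE => sy.
have := string_isP_a hP2; rewrite al_al2 -{1}s2E => sa.
have [||||||f [fb fx fy _]] := isP_hom s_p hP sy sa (string0 P2 (pmopp al) (p - s));
  rewrite ?linear0 ?s2E //.
- exact: P_Ey0 hP2.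
- by have := P_Fyl hP2; rewrite sE.
- exact: P_Ea0 hP2.
- exact: P_Fal hP2.
by exists f; split=> // i; rewrite -s2E => ?; [exact: fx|exact: fy].
Qed.

End Pair.

(** * Traces on linked projectives *)

Section LinkedProjectives.
Variables (al al2 : pm) (s s2 : nat) (P P2 : fdmod A).
Variables (b x y a : nat -> P) (b2 x2 y2 a2 : nat -> P2).
Hypotheses (s_gt0 : (0 < s)%N) (s2_gt0 : (0 < s2)%N) (s_s2 : (s + s2 = p)%N).
Hypothesis al_al2 : al2 = pmopp al.
Hypotheses (hP : isP q p E F K al s b x y a).
Hypotheses (hP2 : isP q p E F K al2 s2 b2 x2 y2 a2).
Variables (nu : modhom P P) (nu2 : modhom P2 P2).
Hypotheses (nu_b : nu (b 0%N) = a 0%N) (nu2_b : nu2 (b2 0%N) = a2 0%N).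
Variable t : trace_family A.

Let s_p : (0 < s < p)%N. Proof. by lia. Qed.
Let s2_p : (0 < s2 < p)%N. Proof. by lia. Qed.
Let s2_s : (s2 + s = p)%N. Proof. by lia. Qed.
Let s2E : (p - s = s2)%N. Proof. by lia. Qed.
Let al2_al : al = pmopp al2. Proof. by rewrite al_al2; case: al. Qed.

(* The two nilpotents are [g o f] and [f o g] for the maps [f : b |-> x2] and
   [g : b2 |-> y] between the two modules of the same block. *)
Lemma trace_nilpotent_swap : trace_on_proj t -> projective P -> projective P2 ->
  t P nu = t P2 nu2.
Proof.
move=> ht projP projP2.
have [f [fb _ fy]] := isP_hom_x s_gt0 s2_gt0 s_s2 al_al2 hP hP2.
have [g [gb gx _]] := isP_hom_y s2_gt0 s_gt0 s2_s al2_al hP2 hP.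
have -> : nu = comphom g f.
  by apply: (isP_hom_eq s_p hP s_gt0); rewrite comphomE fb // gx.
have -> : nu2 = comphom f g.
  by apply: (isP_hom_eq s2_p hP2 s2_gt0); rewrite comphomE gb // fy.
exact: ht.
Qed.

(** It suffices that [e u b_i = c b_i + d a_i], with [c], [d] the coefficients in [u b_i]. Indeed
    [e] acts on the [a_l] as on the [b_l], because [a_l = nu b_l], and kills all [x_j] and [y_k],
    which are images of the [b2] under maps from [P2]. *)
Lemma corner_isP (e u : A) (i : 'I_s) :
  (forall j, (j < s)%N -> act P e (b j) = if j == i then b i else 0) ->
  (forall k, (k < s2)%N -> act P2 e (b2 k) = 0) ->
  exists h : modhom P P, h (b i) = act P (e * u) (b i) /\
    t P h = t P (idhom P) * coord (stdbasis p s b x y a) (ord_b i) (act P u (b i))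
            + t P nu * Hmx p s b x y a u i i.
Proof.
move=> eb eb2; set c := coord _ _ _; set d := Hmx _ _ _ _ _ _ _ _ _.
exists (c *: idhom P + d *: nu); split; last first.
  by rewrite linearD !linearZ; congr (_ + _); apply: mulrC.
have nuE := isP_nilp_b hP nu_b.
have ea l : (l < s)%N -> act P e (a l) = if l == i then a i else 0.
  move=> l_s; rewrite -nuE // -modhomE eb //.
  by case: eqP => _; rewrite ?linear0 // nuE.
have [f [fb _ _]] := isP_hom_x s2_gt0 s_gt0 s2_s al2_al hP2 hP.
have [g [gb _ _]] := isP_hom_y s2_gt0 s_gt0 s2_s al2_al hP2 hP.
have ex j : (j < s2)%N -> act P e (x j) = 0.
  by move=> j_s; rewrite -fb // -modhomE eb2 // linear0.
have ey k : (k < s2)%N -> act P e (y k) = 0.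
  by move=> k_s; rewrite -gb // -modhomE eb2 // linear0.
rewrite actME (isP_expand hP (act P e)).
rewrite [X in _ + X + _ + _]big1 => [|k _]; last by rewrite ex ?scaler0 // -s2E.
rewrite [X in _ + X + _]big1 => [|k _]; last by rewrite ey ?scaler0 // -s2E.
rewrite !addr0 (bigD1 i) //= big1 => [|k ki]; last first.
  by rewrite eb // val_eqE (negbTE ki) scaler0.
rewrite addr0 [X in _ = _ + X](bigD1 i) //= [X in _ = _ + (_ + X)]big1 => [|k ki].
  by rewrite addr0 eb // ea // eqxx !lfunE /= !lfunE /= id_lfunE nuE // /d mxE.
by rewrite ea // val_eqE (negbTE ki) scaler0.
Qed.

End LinkedProjectives.

Lemma corner_isX al s (X : fdmod A) (v : nat -> X) (t : trace_family A)
    (e u : A) (i : 'I_s) :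
  isX q E F K al s v ->
  (forall j, (j < s)%N -> act X e (v j) = if j == i then v i else 0) ->
  exists h : modhom X X, h (v i) = act X (e * u) (v i) /\
    t X h = t X (idhom X) * coord [tuple v j | j < s] i (act X u (v i)).
Proof.
move=> hX ev; set c := coord _ _ _.
exists (c *: idhom X); split; last by rewrite linearZ; apply: mulrC.
rewrite lfunE /= lfunE /= actME.
have vE m : m = \sum_(j < s) coord [tuple v j | j < s] j m *: v j.
  rewrite [LHS](coord_basis (X_basis hX) (memvf m)).
  by apply: eq_bigr => j _; rewrite -tnth_nth tnth_mktuple.
rewrite [in RHS](vE (act X u (v i))) linear_sum (bigD1 i) //= big1 => [|k ki].
  by rewrite linearZ /= ev // eqxx addr0.
by rewrite linearZ /= ev // val_eqE (negbTE ki) scaler0.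
Qed.

End Strings.

(** * The root of unity and the spectrum *)

Section Root.
Variables (C : fieldType) (q : C) (p : nat).
Hypotheses (p_gt1 : (1 < p)%N) (q_prim : (2 * p).-primitive_root q).

Lemma root_neq0 : q != 0.
Proof.
apply/eqP => q0; have /eqP := prim_expr_order q_prim.
by rewrite q0 expr0n (_ : _ == 0%N = false) ?(eq_sym 0) ?oner_eq0 //; lia.
Qed.

Lemma root_expp : q ^+ p = -1.
Proof.
have := prim_expr_order q_prim; rewrite mulnC exprM => /eqP.
rewrite sqrf_eq1 => /orP[|/eqP //].
by rewrite -(prim_order_dvd q_prim) => /dvdn_leq; lia.
Qed.

Lemma root_subV_neq0 n : (0 < n < p)%N -> q ^+ n - q ^- n != 0.
Proof.
move=> n_p; rewrite subr_eq0 -(inj_eq (mulIf (expf_neq0 n root_neq0))).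
rewrite mulVf ?expf_neq0 ?root_neq0 // -exprD -(prim_order_dvd q_prim).
by apply/negP => /dvdn_leq; lia.
Qed.

Lemma qint_root_neq0 n : (0 < n < p)%N -> qint q n != 0.
Proof.
move=> n_p; rewrite mulf_neq0 ?root_subV_neq0 // invr_neq0 //.
by have := @root_subV_neq0 1; rewrite expr1; apply.
Qed.

(** Since [q ^+ p = -1], signs become exponents, and weights and Casimir eigenvalues can be compared
    modulo [2 * p]. *)
Definition sgn_exp al := if al is Plus then 0%N else p.

Lemma sgn_expE al : sgn C al = q ^+ sgn_exp al.
Proof. by case: al; rewrite //= root_expp. Qed.

Lemma wt_root al s i : q ^+ (2 * i).+1 * wt q al s i = q ^+ (sgn_exp al + s).
Proof.
rewrite exprD -sgn_expE /wt mulrCA; congr (_ * _).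
rewrite (exprnP q (2 * i).+1) (exprnP q s) -expfzDr ?root_neq0 //.
congr (q ^ _); lia.
Qed.

(* [F E] differs from the Casimir element by a function of [K], and [Q + Q^-1]
   is the Casimir eigenvalue up to scaling. *)
Lemma casimir_root al s i (Q := q ^+ (sgn_exp al + s)) : (i <= s)%N ->
  (q - q^-1) ^+ 2 * (sgn C al * qint q i * qint q (s - i)) =
  Q + Q^-1 - q * wt q al s i - (q * wt q al s i)^-1.
Proof.
move=> i_s; have q0 := root_neq0.
have d0 : q - q^-1 != 0 by have := @root_subV_neq0 1; rewrite expr1; apply.
have -> : wt q al s i = Q / (q * (q ^+ i * q ^+ i)).
  apply: (canRL (mulfK _)); first by rewrite !mulf_neq0 ?expf_neq0.
  by rewrite -exprD -exprS addnn -mul2n /Q -(wt_root _ _ i) mulrC.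
rewrite {}/Q exprD -sgn_expE /qint expfB_cond ?(negbTE q0) //.
have u0 := expf_neq0 i q0; have w0 := expf_neq0 s q0.
move: (q ^+ i) (q ^+ s) u0 w0 => u w u0 w0.
have -> : (q - q^-1) ^+ 2 * (sgn C al * ((u - u^-1) / (q - q^-1))
            * ((w / u - (w / u)^-1) / (q - q^-1)))
          = sgn C al * (u - u^-1) * (w / u - (w / u)^-1).
  by move: (q - q^-1) d0 => d d0; field; rewrite u0 w0 d0.
by case: al => /=; field; rewrite ?oppr_eq0 ?oner_eq0 u0 w0 q0.
Qed.

(** Turns a congruence into an equation without subtraction, fit for [lia]. *)
Lemma modn_eqP m n d : m = n %[mod d] ->
  exists k, m = (n + k * d)%N \/ n = (m + k * d)%N.
Proof.
move=> mn; have [le|/ltnW le] := leqP m n.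
  have : (d %| n - m)%N by rewrite -eqn_mod_dvd // mn.
  by move=> /dvdnP[k kE]; exists k; right; lia.
have : (d %| m - n)%N by rewrite -eqn_mod_dvd // mn.
by move=> /dvdnP[k kE]; exists k; left; lia.
Qed.

(** Put [m = sgn_exp al + s], between 1 and [2 p]. Modulo [2 p], equal weights give
    [m1 + 2 i2 = m2 + 2 i1], and equal Casimir values give [m1 = m2] or [m1 = - m2]. The first
    determines [al], [s] and then [i]. The second leaves, apart from [m1 = m2], opposite signs with
    [s1 + s2 = p]; then [i1 - i2 = s1] modulo [p], against [- s2 < i1 - i2 < s1]. *)
Lemma weight_casimir_inj al1 s1 i1 al2 s2 i2 :
  (i1 < s1 <= p)%N -> (i2 < s2 <= p)%N ->
  wt q al1 s1 i1 = wt q al2 s2 i2 ->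
  sgn C al1 * qint q i1 * qint q (s1 - i1) =
  sgn C al2 * qint q i2 * qint q (s2 - i2) ->
  [/\ al1 = al2, s1 = s2 & i1 = i2].
Proof.
move=> b1 b2 wtE muE.
have [l1 l2] : (i1 <= s1)%N /\ (i2 <= s2)%N by lia.
set m1 := (sgn_exp al1 + s1)%N; set m2 := (sgn_exp al2 + s2)%N.
have qm0 m : q ^+ m != 0 by rewrite expf_neq0 ?root_neq0.
have wE : (m1 + (2 * i2).+1 = m2 + (2 * i1).+1 %[mod 2 * p])%N.
  apply/eqP; rewrite -(eq_prim_root_expr q_prim) (exprD q m1) (exprD q m2).
  rewrite -(wt_root al1 s1 i1) -(wt_root al2 s2 i2) wtE.
  by apply/eqP; ring.
have mE : m1 = m2 %[mod 2 * p] \/ (m1 + m2 = 0 %[mod 2 * p])%N.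
  have := casimir_root al1 l1; rewrite muE casimir_root // wtE => /eqP.
  rewrite !(inj_eq (addIr _)) -/m1 -/m2 => /eqP QE.
  (* With [Q = q ^+ m], the equation [Q1 + 1/Q1 = Q2 + 1/Q2] becomes [(Q1 - Q2) (Q1 Q2 - 1) = 0]. *)
  have : (q ^+ m1 - q ^+ m2) * (q ^+ (m1 + m2) - q ^+ 0) == 0.
    have -> : (q ^+ m1 - q ^+ m2) * (q ^+ (m1 + m2) - q ^+ 0) =
        q ^+ m1 * q ^+ m2
        * ((q ^+ m1 + (q ^+ m1)^-1) - (q ^+ m2 + (q ^+ m2)^-1)).
      by rewrite exprD expr0; field; rewrite !qm0.
    by rewrite QE subrr mulr0.
  rewrite mulf_eq0 !subr_eq0 !(eq_prim_root_expr q_prim).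
  by case/orP => /eqP; [left|right].
have {wE} [k wk] := modn_eqP wE.
have {mE} mE : exists j, m1 = (m2 + j * (2 * p))%N \/ m2 = (m1 + j * (2 * p))%N
    \/ (m1 + m2 = j * (2 * p))%N.
  case: mE => /modn_eqP[j jE]; exists j; first by case: jE; [left|right; left].
  by right; right; case: jE => [->//|/esym/eqP]; rewrite addn_eq0; lia.
case: mE => j; move: wk; rewrite /m1 /m2 {qm0 wtE muE m1 m2}.
(* By size the multiples [k] and [j] are at most 2, so finitely many linear cases remain. *)
case: al1 al2 => [] [] /=; case: k j => [|[|[|k]]] [|[|[|j]]]; rewrite ?mulSn;
  move=> wk mE; split=> //; lia.
Qed.

End Root.

(** * The trace formula *)

Definition bool_of_pm al := if al is Plus then true else false.
Definition pm_of_bool c := if c then Plus else Minus.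
Lemma bool_of_pmK : cancel bool_of_pm pm_of_bool. Proof. by case. Qed.
HB.instance Definition _ := Equality.copy pm (can_type bool_of_pmK).

(** * The index set of the decomposition *)

Section Index.
Variable p : nat.

Definition index_type := (pm * {s : nat & 'I_s})%type.

Definition mk_index al s (i : 'I_s) : index_type :=
  (al, Tagged (fun s => 'I_s) i).

Definition indices : seq index_type :=
  [seq (al, w) | al <- [:: Plus; Minus],
     w <- [seq Tagged (fun s => 'I_s) i | s <- index_iota 1 p.+1, i <- enum 'I_s]].

Lemma uniq_indices : uniq indices.
Proof.
apply: allpairs_uniq => //; last by move=> [? ?] [? ?].
apply: allpairs_uniq_dep => [|s _|]; first exact: iota_uniq.
  exact: enum_uniq.
by move=> [s i] [s' i'] _ _ /=.
Qed.

Lemma mem_indices al s (i : 'I_s) :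
  (mk_index al i \in indices) = (0 < s <= p)%N.
Proof.
apply/allpairsP/idP => [[[al' w] /= [_ /allpairsPdep[s' [i' [s'p _ ->]]] kE]]|sp].
  have /= -> := congr1 (fun k : index_type => tag k.2) kE.
  by move: s'p; rewrite mem_index_iota.
exists (al, Tagged (fun s => 'I_s) i); split=> //=; first by case: al.
by apply/allpairsPdep; exists s, i; rewrite mem_index_iota mem_enum.
Qed.

Lemma indices_ind (Q : index_type -> Prop) :
  (forall al s (i : 'I_s), (0 < s <= p)%N -> Q (mk_index al i)) ->
  forall k, k \in indices -> Q k.
Proof. by move=> QP [al [s i]] kD; apply: QP; rewrite -(mem_indices al i). Qed.

Lemma big_indices (R : Type) (idx : R) (op : Monoid.com_law idx) f :
  \big[op/idx]_(k <- indices) f k =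
  op (\big[op/idx]_(1 <= s < p.+1) \big[op/idx]_(i < s) f (mk_index Plus i))
     (\big[op/idx]_(1 <= s < p.+1) \big[op/idx]_(i < s) f (mk_index Minus i)).
Proof.
rewrite big_allpairs_dep !big_cons big_nil Monoid.mulm1 !big_allpairs_dep.
by congr (op _ _); apply: eq_bigr => s _; rewrite big_enum.
Qed.

End Index.

(** * Decomposition of the quantum group and evaluation of the trace *)

Section TraceFormula.
Variables (C : fieldType) (q : C) (p : nat).
Hypotheses (p_gt1 : (1 < p)%N) (q_prim : (2 * p).-primitive_root q).
Variables (U : falgType C) (E F K : U) (hU : isUbar q p E F K).
Variables (X : pm -> nat -> fdmod U) (v : forall al s, nat -> X al s).
Hypothesis hX : forall al s, (1 <= s <= p)%N -> isX q E F K al s (v al s).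
Variables (P : pm -> nat -> fdmod U) (b x y a : forall al s, nat -> P al s).
Hypothesis hP : forall al s, (1 <= s <= p - 1)%N ->
  isP q p E F K al s (b al s) (x al s) (y al s) (a al s).
Variable pe : forall al s, modhom (P al s) (P al s).
Hypothesis hpe : forall al s, (1 <= s <= p - 1)%N ->
  pe al s (b al s 0%N) = a al s 0%N.

Let genU : agenv <<[:: E; F; K]>>%VS = {:U}%VS := Ubar_gen hU.
Let qn0 := qint_root_neq0 p_gt1 q_prim.

Let hP' al s : (0 < s < p)%N ->
  isP q p E F K al s (b al s) (x al s) (y al s) (a al s).
Proof. by move=> s_p; apply: hP; lia. Qed.

(* The second vector is the image of the first under the nilpotent
   endomorphism; it vanishes for the Steinberg modules [X al p]. *)
Definition summand (k : index_type) : {M : fdmod U & (M * M)%type} :=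
  let: (al, existT s i) := k in
  if s == p then existT (fun M : fdmod U => (M * M)%type) (X al s) (v al s i, 0)
  else existT (fun M : fdmod U => (M * M)%type) (P al s) (b al s i, a al s i).

Let M k : fdmod U := projT1 (summand k).
Let bM k : M k := (projT2 (summand k)).1.
Let aM k : M k := (projT2 (summand k)).2.
Let wtM (k : index_type) := wt q k.1 (tag k.2) (tagged k.2).
Let muM (k : index_type) :=
  sgn C k.1 * qint q (tagged k.2) * qint q (tag k.2 - tagged k.2).

Let lt_p s : (0 < s <= p)%N -> s <> p -> (0 < s < p)%N.
Proof. lia. Qed.

(** The separating elements are [K] and [F * E]; on the projectives the latter is not diagonal, its
    nilpotent part being [b_i |-> a_i]. *)
Lemma summand_separated k : k \in indices p -> forall m : M k,
  exists2 u : U, act (M k) u (bM k) = m &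
    forall j, j \in indices p -> j != k -> act (M j) u (bM j) = 0.
Proof.
move=> kD m.
apply: (spectral_separation (T := F * E) (K := K) (a := aM) (wt := wtM)
  (mu := muM)) kD => {k m}.
- apply: indices_ind => al s i s_p; rewrite /M /bM /wtM /=.
  case: eqP => /= [_|/(lt_p s_p) s_lt]; first exact: X_K (hX al s_p) _ _.
  exact: P_Kb (hP' al s_lt) _ _.
- apply: indices_ind => al s i s_p; rewrite /M /aM /wtM /=.
  case: eqP => /= [_|/(lt_p s_p) s_lt]; first by rewrite linear0 scaler0.
  exact: P_Ka (hP' al s_lt) _ _.
- apply: indices_ind => al s i s_p; rewrite /M /bM /aM /muM /=.
  case: eqP => /= [_|/(lt_p s_p) s_lt]; last first.
    exact: (isP_FEb (hP' al s_lt) (ltn_ord i)).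
  rewrite addr0.
  exact: (string_FE (string_isX (hX al s_p)) (X_E0 (hX al s_p)) (ltn_ord i)).
- apply: indices_ind => al s i s_p; rewrite /M /aM /muM /=.
  case: eqP => /= [_|/(lt_p s_p) s_lt]; first by rewrite linear0 scaler0.
  exact: (string_FE (string_isP_a (hP' al s_lt)) (P_Ea0 (hP' al s_lt))
    (ltn_ord i)).
- move=> j k; move: j; apply: indices_ind => al1 s1 i1 s1_p.
  move: k; apply: indices_ind => al2 s2 i2 s2_p wE mE.
  have b1 : (i1 < s1 <= p)%N by rewrite ltn_ord; case/andP: s1_p.
  have b2 : (i2 < s2 <= p)%N by rewrite ltn_ord; case/andP: s2_p.
  have [-> e2 e3] : [/\ al1 = al2, s1 = s2 & i1 = i2 :> nat].
    exact: (weight_casimir_inj p_gt1 q_prim b1 b2 wE mE).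
  by case: _ / e2 i2 e3 {s2_p wE mE b2} => i2 /val_inj ->.
move=> k + c d + c0; move: k; apply: indices_ind => al s i s_p.
rewrite /M /bM /aM /=; case: eqP => /= [_|/(lt_p s_p) s_lt] m.
  rewrite scaler0 addr0.
  exact: (cyclic_isX qn0 s_p (hX al s_p) m (ltn_ord i) c0).
exact: (cyclic_isP qn0 s_lt (hP' al s_lt) m d (ltn_ord i) c0).
Qed.

(** Each sign contributes [p] copies of dimension [p] and, for each [s < p], [s] copies of dimension
    [2 p]: together [p^2 + p^2 (p - 1) = p^3]. *)
Lemma dim_summands : (\sum_(k <- indices p) \dim {:M k} = \dim {:U})%N.
Proof.
rewrite (Ubar_dim hU) big_indices /=.
have dM al s (i : 'I_s) : (0 < s <= p)%N ->
    \dim {:M (mk_index al i)} = (if s == p then p else 2 * p)%N.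
  move=> s_p; rewrite /M /=; case: eqP => /= [sE|/(lt_p s_p) s_lt].
    by rewrite (dim_isX (hX al s_p)).
  exact: dim_isP s_lt (hP' al s_lt).
have sM al : (\sum_(1 <= s < p.+1) \sum_(i < s) \dim {:M (mk_index al i)}
              = p * p + \sum_(1 <= s < p) s * (2 * p))%N.
  rewrite big_nat_recr /=; last by lia.
  rewrite addnC; congr (_ + _)%N.
    rewrite (eq_bigr (fun=> p)) ?sum_nat_const ?card_ord // => i _.
    by rewrite dM ?eqxx //; lia.
  apply: eq_big_nat => s s_p; rewrite (eq_bigr (fun=> (2 * p)%N)) => [|i _].
    by rewrite sum_nat_const card_ord.
  by rewrite dM; [case: eqP => //; lia|lia].
have sumE n : (2 * \sum_(1 <= s < n.+1) s = n * n.+1)%N.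
  elim: n => [|n IH]; first by rewrite big_geq.
  by rewrite big_nat_recr //= mulnDr IH; nia.
have {sumE} := sumE p.-1; rewrite !sM -big_distrl /= prednK; last by lia.
set S := (\sum_(_ <= _ < _) _)%N => SE.
have -> : (S * (2 * p) = p.-1 * p * p)%N by rewrite mulnA (mulnC S) SE.
by case: p p_gt1 => // n _; rewrite /= !expnS expn0; nia.
Qed.

(** The coefficient [c] is read off in [X al s] also for [s < p]: by [coord_top] it equals that of
    [b_i], and summing over [i] then gives the character of the simple module. *)
Definition corner_trace (t : trace_family U) (u : U) al s (i : 'I_s) : C :=
  let c := coord [tuple v al s j | j < s] i (act (X al s) u (v al s i)) in
  if s == p then t (X al s) (idhom (X al s)) * c
  else t (P al s) (idhom (P al s)) * c
     + t (P al s) (pe al s)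
       * Hmx p s (b al s) (x al s) (y al s) (a al s) u i i.

Lemma Pi_expansion (t : trace_family U) (u : U) : trace_on_proj t ->
  Pi t u =
    \sum_(1 <= s < p.+1) \sum_(i < s) corner_trace t u Plus i
  + \sum_(1 <= s < p.+1) \sum_(i < s) corner_trace t u Minus i.
Proof.
move=> ht.
have [e eP] := separating_elements summand_separated.
pose T (k : index_type) := corner_trace t u k.1 (tagged k.2).
transitivity (\sum_(k <- indices p) T k); last by rewrite big_indices.
apply: (Pi_separated (uniq_indices p) summand_separated dim_summands eP ht).
apply: indices_ind => al s i s_p.
have kD : mk_index al i \in indices p by rewrite mem_indices.
have eb al2 s2 (j : 'I_s2) : (0 < s2 <= p)%N ->
    act (M (mk_index al2 j)) (e (mk_index al i)) (bM (mk_index al2 j)) =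
    if mk_index al i == mk_index al2 j then bM (mk_index al2 j) else 0.
  by move=> s2_p; rewrite eP ?mem_indices.
have ijE (j : 'I_s) : (mk_index al i == mk_index al j) = (j == i).
  by rewrite xpair_eqE eqxx eq_Tagged eq_sym.
move: eb; rewrite /T /corner_trace /M /bM /=; move: (e _) => ek eb {T}.
case: eqP => /= [sE|/(lt_p s_p) s_lt].
  apply: (corner_isX t u (hX al s_p)) => j j_s.
  have := eb al s (Ordinal j_s) s_p; rewrite ijE -val_eqE /=.
  have -> : (s == p) = true by apply/eqP.
  by case: eqP => // ->.
have [h [hb th]] : exists h : modhom (P al s) (P al s),
    h (b al s i) = act (P al s) (ek * u) (b al s i) /\
    t (P al s) h = t (P al s) (idhom (P al s)) *
      coord (stdbasis p s (b al s) (x al s) (y al s) (a al s)) (ord_b p i)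
        (act (P al s) u (b al s i)) +
      t (P al s) (pe al s) * Hmx p s (b al s) (x al s) (y al s) (a al s) u i i.
  have s2_lt : (0 < p - s < p)%N by lia.
  apply: (corner_isP genU (al2 := pmopp al) (s2 := p - s) _ _ _ _
    (hP' al s_lt) (hP' _ s2_lt)).
  - by lia.
  - by lia.
  - by lia.
  - by [].
  - by apply: hpe; lia.
  - move=> j j_s; have := eb al s (Ordinal j_s) s_p; rewrite ijE -val_eqE /=.
    have -> : (s == p) = false by apply/eqP; lia.
    by case: eqP => // ->.
  (* The linked projective has the opposite sign, so its indices differ from that of [ek], which
     therefore kills its [b_k]. *)
  move=> k k_s; have := eb (pmopp al) _ (Ordinal k_s) (ltac:(lia)).
  have -> : (p - s == p)%N = false by apply/eqP; lia.
  by rewrite xpair_eqE; case: (al).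
exists h; split=> //; rewrite th.
by rewrite (coord_top genU _ _ _ s_lt (hP' al s_lt) (hX al s_p)).
Qed.

Lemma projective_P (al : pm) s : (0 < s < p)%N -> projective (P al s).
Proof.
move=> s_p; have [e eP] := separating_elements summand_separated.
have s_gt0 : (0 < s)%N by lia.
have kD : mk_index al (Ordinal s_gt0) \in indices p by rewrite mem_indices; lia.
have := projective_separated (uniq_indices p) summand_separated dim_summands
  eP kD.
by rewrite /M /=; case: eqP => //; lia.
Qed.

(** Summing the corner traces over [i] gives characters and traces of [H]. The terms in [H Minus]
    are reindexed by [s |-> p - s] and join those in [H Plus], because linked nilpotents have equal
    trace. *)
Theorem trace_formula (t : trace_family U) (ht : trace_on_proj t) :
  let chi al s := modchar (X al s) in
  let H al s := Hmx p s (b al s) (x al s) (y al s) (a al s) in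
  let G s u := \tr (H Plus s u) + \tr (H Minus (p - s)%N u) in
  forall u : U,
  Pi t u =
    t (X Plus p) (idhom (X Plus p)) * chi Plus p u
    + t (X Minus p) (idhom (X Minus p)) * chi Minus p u
    + \sum_(1 <= s < p)
        (t (P Plus s) (idhom (P Plus s)) * chi Plus s u
         + t (P Minus s) (idhom (P Minus s)) * chi Minus s u
         + t (P Plus s) (pe Plus s) * G s u).
Proof.
move=> chi H G u; rewrite (Pi_expansion u ht).
have TE al : \sum_(1 <= s < p.+1) \sum_(i < s) corner_trace t u al i =
    t (X al p) (idhom (X al p)) * chi al p u
    + \sum_(1 <= s < p) (t (P al s) (idhom (P al s)) * chi al s u
                         + t (P al s) (pe al s) * \tr (H al s u)).
  rewrite big_nat_recr /=; last by lia.
  rewrite addrC; congr (_ + _).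
    rewrite /chi (modchar_isX u (hX al (s := p) _)); last by lia.
    by rewrite mulr_sumr; apply: eq_bigr => i _; rewrite /corner_trace eqxx.
  apply: eq_big_nat => s s_p; have s_le : (1 <= s <= p)%N by lia.
  rewrite /chi (modchar_isX u (hX al s_le)) /mxtrace !mulr_sumr -big_split /=.
  apply: eq_bigr => i _; rewrite /corner_trace ifN //.
  by apply/eqP; lia.
have swap s : (0 < s < p)%N ->
    t (P Minus (p - s)) (pe Minus (p - s)) = t (P Plus s) (pe Plus s).
  move=> s_p; have s2_p : (0 < p - s < p)%N by lia.
  apply: (trace_nilpotent_swap genU qn0 (al := Minus) _ _ _ _
    (hP' Minus s2_p) (hP' Plus s_p) _ _ ht) => //; try lia.
  - by apply: hpe; lia.
  - by apply: hpe; lia.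
  - exact: projective_P.
  exact: projective_P.
rewrite !TE !big_split /= addrACA; congr (_ + _).
have -> : \sum_(1 <= s < p) t (P Minus s) (pe Minus s) * \tr (H Minus s u) =
    \sum_(1 <= s < p) t (P Plus s) (pe Plus s) * \tr (H Minus (p - s)%N u).
  rewrite big_nat_rev /=; apply: eq_big_nat => s s_p.
  by rewrite add1n subSS swap.
under [X in _ = _ + X]eq_bigr => s _ do rewrite mulrDr.
by rewrite big_split /= addrACA.
Qed.

End TraceFormula.

(** * The complex root of unity with argument [pi / p] *)

Section RootOfUnity.
Variables (R : realType) (p : nat).
Hypothesis p_gt0 : (0 < p)%N.

Lemma de_Moivre (z : R) n :
  (cos z +i* sin z)%C ^+ n = (cos (n%:R * z) +i* sin (n%:R * z))%C.
Proof.
elim: n => [|n IH]; first by rewrite expr0 mul0r cos0 sin0.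
rewrite exprS IH -natr1 mulrDl mul1r cosD sinD.
by simpc; congr (_ +i* _)%C; ring.
Qed.

(** For [0 < n < p] the imaginary part of [q ^+ n] is positive, so [q ^+ n] is not 1; [q ^+ p = -1]
    reduces the exponents between [p] and [2 p] to this range. *)
Lemma qroot_primitive : (2 * p).-primitive_root (qroot R p).
Proof.
have p0 : (p%:R : R) != 0 by rewrite pnatr_eq0; lia.
have qp : qroot R p ^+ p = -1.
  rewrite de_Moivre mulrCA divff // mulr1 cospi sinpi.
  by apply/eqP; rewrite eq_complex /= oppr0 !eqxx.
have qn n : (0 < n < p)%N -> complex.Im (qroot R p ^+ n) != 0.
  move=> n_p; rewrite de_Moivre /= gt_eqF // sin_gt0_pi //.
  have pR : 0 < (p%:R : R) by rewrite ltr0n.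
  have np : 0 < (n%:R / p%:R : R) < 1.
    by rewrite divr_gt0 ?ltr0n ?ltr_pdivrMr ?mul1r ?ltr_nat //; lia.
  have := pi_gt0 R; move: (pi : R) => w w0; rewrite mulrCA.
  by case/andP: np => np0 np1; rewrite mulr_gt0 //= gtr_pMr.
have q1 n : (0 < n < 2 * p)%N -> qroot R p ^+ n != 1.
  move=> n_p; case: (ltngtP n p) => np.
  - by apply: contraNneq (qn n _) => [->|]; rewrite ?eqxx //; lia.
  - have -> : n = (p + (n - p))%N by lia.
    rewrite exprD qp mulN1r eqr_oppLR.
    apply: contraNneq (qn (n - p)%N _) => [->|]; last by lia.
    by rewrite /= oppr0.
  by rewrite np qp -subr_eq0 -opprD oppr_eq0 -mulr2n pnatr_eq0.
apply/andP; split; first by lia.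
apply/forallP => i; apply/eqP; rewrite unity_rootE.
have := ltn_ord i; rewrite leq_eqVlt => /orP[/eqP ->|i_p].
  by rewrite mulnC exprM qp sqrrN expr1n !eqxx.
by rewrite (negbTE (q1 _ _)) ?i_p // ltn_eqF.
Qed.

End RootOfUnity.

Theorem theorem4p2 (R : realType) (p : nat) (hp : (2 <= p)%N)
  (U : falgType R[i]) (E F K : U) (hU : isUbar (qroot R p) p E F K)
  (* X^al(s) with its basis *)
  (X : pm -> nat -> fdmod U) (v : forall al s, nat -> X al s)
  (hX : forall al s, (1 <= s <= p)%N ->
     isX (qroot R p) E F K al s (v al s))
  (* P^al(s) with its standard basis *)
  (P : pm -> nat -> fdmod U) (b x y a : forall al s, nat -> P al s)
  (hP : forall al s, (1 <= s <= p - 1)%N ->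
     isP (qroot R p) p E F K al s (b al s) (x al s) (y al s) (a al s))
  (* p^al_s *)
  (pe : forall al s, modhom (P al s) (P al s))
  (hpe : forall al s, (1 <= s <= p - 1)%N -> pe al s (b al s 0%N) = a al s 0%N)
  (t : trace_family U) (ht : trace_on_proj t) :
  let chi al s := modchar (X al s) in
  let H al s := Hmx p s (b al s) (x al s) (y al s) (a al s) in
  let G s u := \tr (H Plus s u) + \tr (H Minus (p - s)%N u) in
  forall u : U,
  Pi t u =
    t (X Plus p) (idhom (X Plus p)) * chi Plus p u
    + t (X Minus p) (idhom (X Minus p)) * chi Minus p u
    + \sum_(1 <= s < p)
        (t (P Plus s) (idhom (P Plus s)) * chi Plus s u
         + t (P Minus s) (idhom (P Minus s)) * chi Minus s u
         + t (P Plus s) (pe Plus s) * G s u).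
Proof.
exact: (trace_formula hp (qroot_primitive R (ltnW hp)) hU hX hP hpe ht).
Qed.
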